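(* Let $m,n$ be positive integers with $d=m-n>0$. Then: (A) if $d$ is odd, then $z=0$ is a simple root of $P_{(m,n)}(z)$; (B) if $d$ is even, then $z=0$ and $z=n$ are simple roots of $P_{(m,n)}(z)$; (C) all real roots of $P_{(m,n)}(z)$ lie in $[0,n]$.
   Context: $S(m,n)$ denotes the Stirling number of the second kind. For positive integers $m,n$ with $d=m-n>0$, define the polynomial $P_{(m,n)}(z)=\sum_{j=1}^{d}\binom{m}{j}S(m-j,n)(-z)^{j}$. *)

(* Defs.v *)
From mathcomp Require Import all_boot all_order all_algebra.
From mathcomp Require Import reals.

Set Implicit Arguments.
Unset Strict Implicit.
Unset Printing Implicit Defensive.

Import Order.TTheory GRing.Theory Num.Theory.
Local Open Scope ring_scope.

(* [partition] requires the blocks to be nonempty. *)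
Definition stirling2 (m n : nat) : nat :=
  #|[set Q : {set {set 'I_m}} | partition Q [set: 'I_m] & #|Q| == n]|.

(* [m - n] is truncated; the polynomial is only of interest for [n < m]. *)
Definition stirlingP (R : realType) (m n : nat) : {poly R} :=
  \sum_(1 <= j < (m - n).+1)
    ('C(m, j) * stirling2 (m - j) n)%:R *: (- 'X) ^+ j.

(* As [mup x 0 = 0], this forces [p != 0]. *)
Definition simple_root (R : realType) (p : {poly R}) (x : R) : Prop :=
  mup x p = 1%N.

(* Main.v *)
Require Import Defs.
From mathcomp Require Import all_boot all_order all_algebra.
From mathcomp Require Import reals.
From mathcomp Require Import zify ring.
Import Order.TTheory GRing.Theory Num.Theory.
Local Open Scope ring_scope.

(** Write P for the polynomial and add the missing term j = 0, of value S(m, n):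
    Q(z) = sum_(j <= m) C(m, j) S(m - j, n) (-z)^j, so that P(z) = Q(z) - Q(0).

    The key fact is the reflection Q(n - z) = (-1)^(m - n) Q(z)
    ([stirlingQ_sym]).  It comes from the alternating formula
    n! S(m, n) = sum_k (-1)^(n - k) C(n, k) k^m: after summation over j with
    the binomial theorem, n! Q(z) = sum_k (-1)^(n - k) C(n, k) (k - z)^m
    ([stirlingQ_explicit]), which is the n-th finite difference of x^m at -z,
    and the exchange of k with n - k reflects it.

    Simple roots: P(0) = 0 and P'(0) = - m S(m - 1, n), which is nonzero since
    0 < n <= m - 1.  When m - n is even, P(n - z) = P(z), which carries the
    simple root 0 to n.

    Location: for x < 0 every term of Q(x) is nonnegative and the term j = 1 is
    positive, so Q(x) > S(m, n) ([stirlingQ_gt]).  For x > n apply this to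
    n - x: the reflection gives Q(x) > S(m, n) if m - n is even, and
    Q(x) < - S(m, n) <= S(m, n) if it is odd.  In all cases P(x) is nonzero.

    The alternating formula is proved by induction on n, splitting the
    partitions of a set according to the block of one chosen element
    ([set_partitions_rec]). *)

(** * Counting set partitions *)

(** Arbitrary ground sets are allowed, rather than full ordinal types only,
    because the recursion below passes to subsets. *)
Definition set_partitions (T : finType) (n : nat) (D : {set T}) :
    {set {set {set T}}} :=
  [set Q | partition Q D & #|Q| == n].

Lemma set_partitions0 (T : finType) (n : nat) :
  #|set_partitions T n set0| = (n == 0)%N.
Proof.
case: n => [|n].
  rewrite (_ : set_partitions T 0 set0 = [set set0]) ?cards1 //.
  apply/setP=> Q; rewrite !inE partition_set0.
  by case: eqP => // ->; rewrite cards0.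
apply/eqP; rewrite cards_eq0 -subset0; apply/subsetP=> Q.
by rewrite !inE partition_set0 => /andP[/eqP-> ]; rewrite cards0.
Qed.

Lemma set_partitions_no_block (T : finType) (D : {set T}) :
  #|set_partitions T 0 D| = (D == set0).
Proof.
case: (eqVneq D set0) => [->|D0]; first by rewrite set_partitions0.
apply/eqP; rewrite cards_eq0 -subset0; apply/subsetP=> Q.
rewrite !inE cards_eq0 => /andP[pQ /eqP Q0]; move/cover_partition: pQ D0.
by rewrite Q0 /cover big_set0 => <-; rewrite eqxx.
Qed.

Lemma set_partitions_small (T : finType) (n : nat) (D : {set T}) :
  (#|D| < n)%N -> #|set_partitions T n D| = 0%N.
Proof.
move=> ltDn; apply/eqP; rewrite cards_eq0 -subset0; apply/subsetP=> Q.
rewrite !inE => /andP[pQ /eqP cQ]; move: ltDn; rewrite -cQ (card_partition pQ).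
rewrite ltnNge -sum1_card leq_sum // => B BQ.
by rewrite card_gt0 (partition_neq0 pQ).
Qed.

(** A partition of [a |: D] is determined by the set [E] of the elements outside
    the block of [a], together with the partition that it induces on [E]. *)
Lemma set_partitions_rec (T : finType) (n : nat) (a : T) (D : {set T}) :
  a \notin D ->
  #|set_partitions T n.+1 (a |: D)|
    = (\sum_(E : {set T} | E \subset D) #|set_partitions T n E|)%N.
Proof.
move=> aD; rewrite -sum1_card.
rewrite (partition_big (fun Q => (a |: D) :\: pblock Q a)
           (fun E : {set T} => E \subset D)) /=; last first.
  move=> Q; rewrite inE => /andP[pQ _].
  have aQ : a \in cover Q by rewrite (cover_partition pQ) setU11.
  apply/subsetP=> x; rewrite !inE => /andP[xQ /predU1P[xa|//]].
  by rewrite xa mem_pblock aQ in xQ.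
apply: eq_bigr => E ED; rewrite sum1_card.
set B := (a |: D) :\: E.
have aE : a \notin E by apply: contra aD; apply/subsetP.
have aB : a \in B by rewrite !inE eqxx aE.
have EaD : E \subset a |: D by apply: subset_trans ED (subsetUr _ _).
have BN Q : Q \in set_partitions T n E -> B \notin Q.
  rewrite inE => /andP[pQ _]; apply/negP=> /(partitionS pQ) /subsetP /(_ a aB).
  exact/negP.
(* [B] is the block of [a]: adding it maps the partitions of [E] bijectively to
   the partitions of [a |: D] whose [a]-block has complement [E]. *)
rewrite -(@card_in_imset _ _ (fun Q => B |: Q) (set_partitions T n E)); last first.
  move=> Q1 Q2 P1 P2 eqQ; have Q1B := BN _ P1; have Q2B := BN _ P2.
  by rewrite -(setU1K Q1B) eqQ setU1K.
apply: eq_card => Q; rewrite unfold_in; apply/andP/imsetP.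
- case; rewrite inE => /andP[pQ /eqP cQ] /eqP defE.
  have aQ : a \in cover Q by rewrite (cover_partition pQ) setU11.
  have BQ : B \in Q.
    suff -> : B = pblock Q a by rewrite pblock_mem.
    rewrite /B -defE setDDr setDv set0U; apply/setIidPr.
    by apply: partitionS pQ _; rewrite pblock_mem.
  exists (Q :\ B); last by rewrite setD1K.
  rewrite inE; apply/andP; split; last by move: cQ; rewrite (cardsD1 B Q) BQ add1n => -[->].
  have := partitionD1 pQ BQ.
  by rewrite /B setDDr setDv set0U (setIidPr EaD).
- case=> Q' Q'P ->; have BQ' := BN _ Q'P.
  move: Q'P; rewrite inE => /andP[pQ' /eqP cQ'].
  have B0 : B != set0 by apply/set0Pn; exists a.
  have dBE : [disjoint B & E] by rewrite -setI_eq0 /B setIDAC setDIl setDv setI0.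
  have pQ := partitionU1 pQ' B0 dBE.
  have BE : B :|: E = a |: D.
    apply/setP=> x; have := subsetP EaD x; rewrite !inE.
    by case: (x \in E) => [->|_] //=; rewrite ?orbT ?orbF.
  rewrite BE in pQ; rewrite inE pQ cardsU1 BQ' cQ' eqxx; split=> //.
  rewrite (def_pblock (partition_trivIset pQ) _ aB) ?setU11 //.
  by rewrite /B setDDr setDv set0U (setIidPr EaD).
Qed.

(** Expand the product over [D] of the factors [x + 1]: a subset of [D] records
    the factors from which [x] is taken. *)
Lemma sum_subset_expr (T : finType) (A : comNzRingType) (x : A) (D : {set T}) :
  \sum_(E : {set T} | E \subset D) x ^+ #|E| = (x + 1) ^+ #|D|.
Proof.
(* The product is extended to the whole type with factors [0 + 1] outside [D],
   so that the subsets that leave [D] contribute nothing. *)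
have -> : (x + 1) ^+ #|D|
    = \prod_(i : T) ((if i \in D then x else 0) + 1).
  rewrite (bigID (mem D)) /= [X in _ * X]big1 ?mulr1; last first.
    by move=> i /negbTE ->; rewrite add0r.
  by rewrite (eq_bigr (fun=> x + 1)) ?prodr_const // => i ->.
rewrite bigA_distr big_mkcond /=; apply: eq_bigr => E _.
rewrite -big_mkcond /=; case: ifPn => ED.
  rewrite (eq_bigr (fun=> x)) ?prodr_const // => i iE.
  by rewrite (subsetP ED).
have [i iE /negbTE iD] := subsetPn ED.
by rewrite (bigD1 i) //= iD mul0r.
Qed.

(** For nonempty [D] and [n.+1] blocks, the recursion sums the formula for [n]
    over the subsets of [D] minus a point; this turns [k ^+ _] into
    [k.+1 ^+ _], and [n.+1 * 'C(n, k) = k.+1 * 'C(n.+1, k.+1)] shifts the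
    index. *)
Lemma set_partitions_explicit (A : comNzRingType) (T : finType) (n : nat)
    (D : {set T}) :
  n`!%:R * #|set_partitions T n D|%:R
    = \sum_(k < n.+1) (-1) ^+ (n - k) * 'C(n, k)%:R * k%:R ^+ #|D| :> A.
Proof.
elim: n D => [|n IHn] D.
  rewrite set_partitions_no_block big_ord1 /= mul1r expr0 !mul1r.
  by rewrite -cards_eq0 -expr0n.
have [->|[a aD]] := set_0Vmem D.
  rewrite set_partitions0 mulr0 cards0.
  (* The alternating sum of the binomials expands [(-1 + 1) ^+ n.+1]. *)
  have : (-1 + 1 : A) ^+ n.+1 = 0 by rewrite addNr expr0n.
  rewrite exprDn => {1}<-; apply: eq_bigr => k _.
  by rewrite expr1n expr0 !mulr1 mulr_natr.
rewrite -(setD1K aD); set D' := D :\ a.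
have aD' : a \notin D' by rewrite !inE eqxx.
rewrite set_partitions_rec // cardsU1 aD' add1n natr_sum.
rewrite big_ord_recl /= exprS mul0r mulr0 add0r.
rewrite factS natrM -mulrA big_distrr /=.
under eq_bigr do rewrite IHn.
rewrite exchange_big /= big_distrr /=; apply: eq_bigr => k _.
rewrite -big_distrr /= sum_subset_expr natr1 /bump leq0n add1n subSS exprS.
have -> : n.+1%:R * ((-1) ^+ (n - k) * 'C(n, k)%:R * k.+1%:R ^+ #|D'|)
   = (-1) ^+ (n - k) * (n.+1 * 'C(n, k))%:R * k.+1%:R ^+ #|D'| :> A.
  by rewrite natrM; ring.
by rewrite mul_bin_diag natrM; ring.
Qed.

(** In the recursion it suffices to keep one subset: the whole [D :\ a] (so that
    [a] is a singleton block), except that with a single block allowed the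
    remainder has to be empty. *)
Lemma set_partitions_gt0 (T : finType) (n : nat) (D : {set T}) :
  (0 < n <= #|D|)%N -> (0 < #|set_partitions T n D|)%N.
Proof.
case: n => [//|n] /=; elim: n D => [|n IHn] D cD.
all: have [a aD] : exists a, a \in D by apply/card_gt0P; apply: leq_trans cD.
all: have aD' : a \notin D :\ a by rewrite !inE eqxx.
all: rewrite -(setD1K aD) set_partitions_rec //.
  by rewrite (bigD1 set0) ?sub0set //= set_partitions0.
rewrite (bigD1 (D :\ a)) //= ltn_addr // IHn //.
by move: cD; rewrite (cardsD1 a) aD.
Qed.

(** * The completed polynomial and its reflection *)

Lemma stirling2_small m n : (m < n)%N -> stirling2 m n = 0%N.
Proof. by move=> lt_mn; apply: set_partitions_small; rewrite cardsT card_ord. Qed.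

Lemma stirling2_gt0 m n : (0 < n <= m)%N -> (0 < stirling2 m n)%N.
Proof. by move=> ?; apply: set_partitions_gt0; rewrite cardsT card_ord. Qed.

Lemma stirling2_explicit (A : comNzRingType) m n :
  n`!%:R * (stirling2 m n)%:R
    = \sum_(k < n.+1) (-1) ^+ (n - k) * 'C(n, k)%:R * k%:R ^+ m :> A.
Proof. by rewrite set_partitions_explicit cardsT card_ord. Qed.

(** The ring is arbitrary so that [x] can be a number, for estimates, as well as
    the indeterminate ['X], for identities between polynomials. *)
Definition stirlingQ (A : comNzRingType) (m n : nat) (x : A) : A :=
  \sum_(j < m.+1) ('C(m, j) * stirling2 (m - j) n)%:R * (- x) ^+ j.

(** Insert the alternating formula for each Stirling number; the sum over [j] is
    then the binomial expansion of [(k%:R - x) ^+ m]. *)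
Lemma stirlingQ_explicit (A : comNzRingType) m n (x : A) :
  n`!%:R * stirlingQ A m n x
    = \sum_(k < n.+1) (-1) ^+ (n - k) * 'C(n, k)%:R * (k%:R - x) ^+ m.
Proof.
rewrite big_distrr /=.
under eq_bigr => j _.
  rewrite mulnC natrM -!mulrA [n`!%:R * _]mulrA stirling2_explicit big_distrl /=.
  over.
rewrite exchange_big /=; apply: eq_bigr => k _.
rewrite exprDn big_distrr /=; apply: eq_bigr => j _.
by rewrite -mulr_natl; ring.
Qed.

(** The exchange of [k] with [n - k] turns [k%:R - (n%:R - x)] into
    [- (k%:R - x)].  The hypothesis on [n`!] allows to cancel it; it holds in
    characteristic zero. *)
Lemma stirlingQ_sym (A : idomainType) m n (x : A) :
  n`!%:R != 0 :> A ->
  stirlingQ A m n (n%:R - x) = (-1) ^+ (m + n) * stirlingQ A m n x.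
Proof.
move=> nf; apply: (mulfI nf); rewrite mulrCA !stirlingQ_explicit big_distrr /=.
rewrite (reindex_inj rev_ord_inj) /=; apply: eq_bigr => k _.
have kn : (k <= n)%N by rewrite -ltnS.
rewrite subSS subKn // bin_sub // natrB //.
rewrite (_ : n%:R - k%:R - (n%:R - x) = - (k%:R - x)); last by ring.
rewrite [(- (_ - x)) ^+ _]exprNn.
have -> : (-1) ^+ k = (-1) ^+ n * (-1) ^+ (n - k) :> A.
  rewrite -exprD -[LHS]signr_odd -[RHS]signr_odd; congr (_ ^+ _); lia.
by rewrite exprD; ring.
Qed.

(** Removing the term of index 0 of [stirlingQ] leaves the indices up to [m];
    those above [m - n] vanish since [stirling2 (m - j) n = 0] for them. *)
Lemma stirlingPE (R : realType) m n :
  stirlingP R m n = stirlingQ {poly R} m n 'X - (stirling2 m n)%:R.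
Proof.
rewrite /stirlingQ big_ord_recl /= bin0 mul1n subn0 mulr1 addrC addKr.
rewrite /stirlingP big_add1 /= -(big_mkord xpredT
  (fun i => ('C(m, i.+1) * stirling2 (m - i.+1) n)%:R * (- 'X : {poly R}) ^+ i.+1)).
rewrite [RHS](@big_cat_nat _ _ _ (m - n)) ?leq_subr //=.
rewrite [X in _ + X]big_nat_cond [X in _ + X]big1 ?addr0; last first.
  by move=> i ?; rewrite stirling2_small ?muln0 ?mul0r //; lia.
by apply: eq_bigr => i _; rewrite scaler_nat mulr_natl.
Qed.

Lemma horner_stirlingP (R : realType) m n (x : R) :
  (stirlingP R m n).[x] = stirlingQ R m n x - (stirling2 m n)%:R.
Proof.
rewrite stirlingPE -polyC_natr hornerD hornerN hornerC horner_sum; congr (_ - _).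
apply: eq_bigr => j _.
by rewrite -polyC_natr hornerCM horner_exp hornerN hornerX.
Qed.

(** All terms are nonnegative at [x < 0], the term of index 0 is the left-hand
    side, and the term of index 1 is positive because [0 < n <= m - 1]. *)
Lemma stirlingQ_gt (R : realDomainType) m n (x : R) :
  (0 < n < m)%N -> x < 0 -> (stirling2 m n)%:R < stirlingQ R m n x.
Proof.
case: m => [|m]; first by lia.
move=> nm x0; rewrite /stirlingQ !big_ord_recl /= subn0 bin0 mul1n mulr1.
rewrite ltrDl ltr_wpDr //.
  by apply: sumr_ge0 => i _; rewrite mulr_ge0 ?exprn_ge0 // oppr_ge0 ltW.
rewrite mulr_gt0 ?exprn_gt0 ?oppr_gt0 // ltr0n muln_gt0 bin_gt0.
by rewrite stirling2_gt0 /bump /=; lia.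
Qed.

(** * Roots of the polynomial *)

Lemma simple_root_deriv (R : realType) (p : {poly R}) (x : R) :
  root p x -> p^`().[x] != 0 -> simple_root p x.
Proof.
move=> /factor_theorem[q ->]; rewrite derivM derivXsubC mulr1 => qx.
have qx0 : ~~ root q x.
  by move: qx; rewrite hornerD hornerM hornerXsubC subrr mulr0 add0r.
by rewrite /simple_root mupMr // -['X - _]expr1 mup_XsubCX eqxx.
Qed.

Lemma deriv_stirlingP0 (R : realType) m n :
  (n < m)%N -> (stirlingP R m n)^`().[0] = - (m * stirling2 m.-1 n)%:R.
Proof.
move=> nm; rewrite horner_coef0 coef_deriv mulr1n /stirlingP big_ltn ?ltnS ?subn_gt0 //.
rewrite coefD coef_sum big_nat_cond big1 => [|j /andP[/andP[j1 _] _]].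
  by rewrite addr0 coefZ coefN coefX bin1 subn1 mulrN1.
rewrite -scaleN1r exprZn scalerA coefZ coefXn.
by rewrite (_ : (1 == j)%N = false) ?mulr0 //; lia.
Qed.

Lemma root_stirlingP0 (R : realType) m n : root (stirlingP R m n) 0.
Proof.
rewrite rootE horner_stirlingP /stirlingQ big_ord_recl /= big1 => [|i _].
  by rewrite subn0 bin0 mul1n mulr1 addr0 subrr.
by rewrite oppr0 expr0n mulr0.
Qed.

Theorem proposition2 (R : realType) (m n : nat)
    (m_gt0 : (0 < m)%N) (n_gt0 : (0 < n)%N) (d_gt0 : (0 < m - n)%N) :
  [/\ odd (m - n) -> simple_root (stirlingP R m n) 0,
      ~~ odd (m - n) -> simple_root (stirlingP R m n) 0
                        /\ simple_root (stirlingP R m n) n%:R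
    & forall x : R, root (stirlingP R m n) x -> 0 <= x <= n%:R].
Proof.
have nm : (n < m)%N by rewrite -subn_gt0.
have sgnE (A : pzRingType) : (-1) ^+ (m + n) = (-1) ^+ odd (m - n) :> A.
  by rewrite -[LHS]signr_odd oddD oddB // ltnW.
have dP0 : (stirlingP R m n)^`().[0] != 0.
  rewrite deriv_stirlingP0 // oppr_eq0 pnatr_eq0 -lt0n muln_gt0 m_gt0 andTb.
  by rewrite stirling2_gt0 //; lia.
have simple0 := simple_root_deriv _ _ _ (root_stirlingP0 R m n) dP0.
have nfP : n`!%:R != 0 :> {poly R}.
  by rewrite -polyC_natr polyC_eq0 pnatr_eq0 -lt0n fact_gt0.
have nfR : n`!%:R != 0 :> R by rewrite pnatr_eq0 -lt0n fact_gt0.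
split=> // [evd|x].
- split=> //; rewrite (negbTE evd) in sgnE.
  have Psym : stirlingP R m n \Po (n%:R%:P - 'X) = stirlingP R m n.
    rewrite !stirlingPE comp_polyB -!polyC_natr comp_polyC; congr (_ - _).
    rewrite -[RHS]mul1r -[1 in RHS]/((-1) ^+ false) -sgnE.
    rewrite -(stirlingQ_sym _ _ _ 'X nfP) -polyC_natr.
    rewrite /stirlingQ raddf_sum; apply: eq_bigr => j _ /=.
    by rewrite -!polyC_natr rmorphM rmorphXn rmorphN /= comp_polyC comp_polyX.
  (* By the reflection, [P(n) = P(0)] and [P'(n) = - P'(0)]. *)
  apply: simple_root_deriv.
    rewrite -Psym rootE horner_comp !hornerE subrr.
    exact: root_stirlingP0.
  move: (congr1 (fun p : {poly R} => p^`().[0]) Psym).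
  rewrite deriv_comp !derivE sub0r mulrN1 hornerN horner_comp !hornerE subr0.
  by move=> E; rewrite -oppr_eq0 E.
- rewrite rootE horner_stirlingP subr_eq0 => /eqP Qx.
  have [x0|x0] := ltP x 0.
    by have := stirlingQ_gt R m n x; rewrite n_gt0 nm Qx ltxx => /(_ isT x0).
  have [//|xn] := leP x n%:R.
  have nx0 : n%:R - x < 0 by rewrite subr_lt0.
  have := stirlingQ_gt R m n _ _ nx0; rewrite n_gt0 nm => /(_ isT).
  rewrite stirlingQ_sym // Qx sgnE; case: odd; last by rewrite mul1r ltxx.
  by rewrite mulN1r ltNge (@le_trans _ _ 0) ?oppr_le0 ?ler0n.
Qed.
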